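(* For every integer $n \geq 15$, there exists a graph on $n$ vertices which is Hamiltonian and chordal, is not fully cycle extendible, and contains no induced path on $9$ vertices.
   Context: All graphs are simple, finite, connected and undirected. A graph is chordal if it has no induced cycle of length at least $4$. A graph $G$ is cycle extendible if for every non-Hamiltonian cycle $C$ of $G$ there is a cycle $C'$ with $V(C) \subset V(C')$ and $|V(C')| = |V(C)| + 1$; it is fully cycle extendible if it is cycle extendible and every vertex lies in a triangle. (Such a graph is a counterexample to Hendry's Conjecture, which asserts that every Hamiltonian chordal graph is fully cycle extendible.) *)

(* Defs.v *)
From mathcomp Require Import all_boot.
Set Implicit Arguments.
Unset Strict Implicit.
Unset Printing Implicit Defensive.

Record sgraph := SGraph {
  svertex :> finType;
  adj : rel svertex;
  adj_sym : symmetric adj;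
  adj_irrefl : irreflexive adj
}.

Arguments adj {s} : rename.

Section Graph.
Variable G : sgraph.
Implicit Types (x y : G) (c p : seq G).

Definition connected_graph : Prop :=
  0 < #|G| /\ forall x y, connect adj x y.

(* A cycle is given by its vertices in cyclic order, so its vertex set is the
   support of [c] and its length is [size c]; [ucycle] alone would also accept
   the empty sequence and the two ends of an edge. *)
Definition is_cycle c : Prop := 2 < size c /\ ucycle adj c.

Definition hamiltonian_cycle c : Prop := is_cycle c /\ forall x, x \in c.

Definition hamiltonian : Prop := exists c, hamiltonian_cycle c.

Definition induced_cycle c : Prop :=
  is_cycle c /\
  {in c &, forall x y, adj x y -> y = next c x \/ x = next c y}.

Definition chordal : Prop :=
  ~ exists c, induced_cycle c /\ 4 <= size c.

Definition induced_path p : Prop :=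
  [/\ uniq p, sorted adj p &
      {in p &, forall x y, adj x y ->
         index y p = (index x p).+1 \/ index x p = (index y p).+1}].

Definition cycle_extendible : Prop :=
  forall c, is_cycle c -> ~ hamiltonian_cycle c ->
  exists c', [/\ is_cycle c', {subset c <= c'} & size c' = (size c).+1].

Definition in_triangle x : Prop :=
  exists y z, [/\ adj x y, adj y z & adj z x].

Definition fully_cycle_extendible : Prop :=
  cycle_extendible /\ forall x, in_triangle x.

End Graph.

(* Main.v *)
Require Import Defs.
From mathcomp Require Import all_boot.
From mathcomp Require Import zify.

(** A chordal graph on [0 .. 9] carries five triangles glued on edges, with tips
    [10 .. 14]; the tip 14 is blown up into a clique of [n - 14] twins, which
    changes neither chordality nor the long induced paths.  A cycle through all
    the tips must use, up to a detour through the tip, each of the five edges.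
    Under this constraint there is a cycle through all vertices and one through
    all vertices but 0 and 1, but none that misses exactly one of 0 and 1.
    For the last point, the clique of twins is separated from the rest by
    [{4, 5}], so one of the two arcs of the cycle between 4 and 5 is exactly the
    clique, and the other is a path in a fixed graph on 14 vertices. *)

(** * Perfect elimination orderings and chordality *)

(** On a cycle, the two neighbours of the vertex with the largest [f] are adjacent; if the length is
    at least 4, they form a chord. *)
Lemma perfect_elimination_chordal (G : sgraph) (f : G -> nat) :
  injective f ->
  (forall x y z, f y < f x -> f z < f x ->
     adj x y -> adj x z -> y != z -> adj y z) ->
  chordal G.
Proof.
move=> f_inj elim_f [c [[[_ /andP[cyc_c uniq_c]] chordless_c] size_c]].
have [x0 x0c] : exists x0, x0 \in c.
  by case: (c) size_c => // x s _; exists x; rewrite mem_head.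
have [m mc max_m] := arg_maxnP (P := mem c) f x0c.
have [i s def_s] := rot_to mc.
have size_s : 4 <= size (m :: s) by rewrite -def_s size_rot.
have mem_s : c =i m :: s by move=> y; rewrite -def_s mem_rot.
have next_s : next c =1 next (m :: s) by move=> y; rewrite -def_s next_rot.
have chordless : {in m :: s &, forall x y, adj x y ->
    y = next (m :: s) x \/ x = next (m :: s) y}.
  by move=> x y xs ys; rewrite -!next_s; apply: chordless_c; rewrite mem_s.
have {max_m} max_m y : y \in s -> m != y -> f y < f m.
  move=> ys my; have : f y <= f m.
    by apply: max_m; rewrite inE mem_s inE ys orbT.
  by rewrite leq_eqVlt => /orP[/eqP/f_inj eq_ym|//]; rewrite eq_ym eqxx in my.
move: cyc_c uniq_c; rewrite -(rot_cycle i) -(rot_uniq i) def_s.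
move: size_s max_m chordless {next_s def_s mem_s}.
case: s => [|y [|w [|v s]]] //= _ max_m chordless.
rewrite rcons_path !inE !negb_or => /and5P[my yw wv vs lm].
case/and5P=> /and4P[ny nw nv ns] /and3P[yw' yv' ys'] /andP[wv' ws'] vs' us.
set z := last v s in lm.
have z_in : z \in v :: s by apply: mem_last.
have z_out u : u \notin v :: s -> u != z.
  by apply: contraNneq => ->.
have mz : m != z by apply: z_out; rewrite inE negb_or nv.
have yz : y != z by apply: z_out; rewrite inE negb_or yv'.
have wz : w != z by apply: z_out; rewrite inE negb_or wv'.
have zs : z \in [:: y, w, v & s] by rewrite 2!inE z_in !orbT.
have adj_yz : adj y z.
  apply: (elim_f m) => //; rewrite ?max_m ?mem_head //.
  by rewrite adj_sym.
(* The successor of [y] is [w] and its predecessor is [m]; both differ from [z]. *)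
have [||z_next|y_next] := chordless y z _ _ adj_yz.
- by rewrite !inE eqxx orbT.
- by rewrite inE zs orbT.
- by move: z_next wz; rewrite eq_sym (negPf ny) eqxx => ->; rewrite eqxx.
- have uniq_c : uniq [:: m, y, w, v & s].
    by rewrite /= !inE !negb_or ny nw nv ns yw' yv' ys' wv' ws' vs' us.
  have := prev_next uniq_c z; rewrite -[next _ z]y_next /=.
  by rewrite eqxx => eq_mz; rewrite eq_mz eqxx in mz.
Qed.

(** * The core graph and its blow-up *)

(* Entry [x] lists the neighbours of [x] below [x]; each entry is a clique, so
   the decreasing order is a perfect elimination ordering. *)
Definition down_nbrs : seq (seq nat) :=
  [:: [::]; [:: 0]; [:: 0; 1]; [:: 0; 1; 2]; [:: 0; 1; 2; 3];
      [:: 0; 2; 3; 4]; [:: 1; 2; 3; 4]; [:: 3; 4; 6]; [:: 2; 3; 4; 5];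
      [:: 2; 5; 8]; [:: 2; 6]; [:: 2; 9]; [:: 3; 7]; [:: 3; 8]; [:: 4; 5]].

(** Made reflexive so that distinct twins, folded onto 14, are adjacent. *)
Definition core_rel (x y : nat) : bool :=
  [|| x == y, x \in nth [::] down_nbrs y | y \in nth [::] down_nbrs x].

Definition fold14 (x : nat) : nat := minn x 14.

Definition blowup_adj (x y : nat) : bool :=
  (x != y) && core_rel (fold14 x) (fold14 y).

Lemma core_rel_sym : symmetric core_rel.
Proof. by move=> x y; rewrite /core_rel eq_sym; congr orb; rewrite orbC. Qed.

Lemma blowup_adj_sym : symmetric blowup_adj.
Proof. by move=> x y; rewrite /blowup_adj eq_sym core_rel_sym. Qed.

Lemma fold14_lt15 x : fold14 x \in iota 0 15.
Proof. rewrite mem_iota /fold14; lia. Qed.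

(** [fold14] is monotone, so a check on 15 vertices suffices; its inequalities are weak because
    twins fold together. *)
Lemma blowup_elimination x y z :
  y < x -> z < x -> blowup_adj x y -> blowup_adj x z -> y != z ->
  blowup_adj y z.
Proof.
move=> yx zx /andP[_ xy] /andP[_ xz] neq_yz; rewrite /blowup_adj neq_yz /=.
have: all (fun a => all (fun b => all (fun c =>
    [&& b <= a, c <= a, core_rel a b & core_rel a c] ==> core_rel b c)
    (iota 0 15)) (iota 0 15)) (iota 0 15) by vm_compute.
move=> /allP/(_ _ (fold14_lt15 x))/allP/(_ _ (fold14_lt15 y)).
move=> /allP/(_ _ (fold14_lt15 z))/implyP; apply.
rewrite xy xz !andbT /fold14; apply/andP; lia.
Qed.

Lemma blowup_separator x y :
  x \notin [:: 4; 5] -> y \notin [:: 4; 5] -> blowup_adj x y ->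
  (x < 14) = (y < 14).
Proof.
move=> x45 y45 /andP[_ xy].
have: all (fun a => all (fun b =>
    [&& a \notin [:: 4; 5], b \notin [:: 4; 5] & core_rel a b] ==>
    ((a < 14) == (b < 14))) (iota 0 15)) (iota 0 15) by vm_compute.
move=> /allP/(_ _ (fold14_lt15 x))/allP/(_ _ (fold14_lt15 y))/implyP.
have fold45 u : u \notin [:: 4; 5] -> fold14 u \notin [:: 4; 5].
  by rewrite !inE /fold14; lia.
rewrite xy !fold45 // => /(_ isT); rewrite /fold14; lia.
Qed.

Lemma path_avoiding_separator s :
  sorted blowup_adj s -> 4 \notin s -> 5 \notin s ->
  all (fun x => x < 14) s \/ all (leq 14) s.
Proof.
case: s => [|x s]; first by left.
elim: s x => [|y s IH] x /=.
  by rewrite !andbT => *; case: ltnP; [left | right].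
move=> /andP[xy ys]; rewrite in_cons negb_or => /andP[x4 s4].
rewrite in_cons negb_or => /andP[x5 s5].
have eq_xy : (x < 14) = (y < 14).
  apply: blowup_separator xy; rewrite !inE negb_or ?(eq_sym x) ?x4 //.
  move: s4 s5; rewrite !inE !negb_or !(eq_sym y).
  by case/andP=> -> _ /andP[->].
have [/= all_lt|/= all_ge] := IH y ys s4 s5; [left | right].
  by rewrite eq_xy; case/andP: all_lt => -> ->.
by rewrite leqNgt eq_xy -leqNgt; case/andP: all_ge => -> ->.
Qed.

(** * Arcs between 4 and 5 inside the core *)

(* The final test allows the path to skip only 0 and 1, the two vertices missed
   by the non-extendible cycle.  The conditional, unlike [&&], is not evaluated
   eagerly by [vm_compute]. *)
Fixpoint arc_search (t k x : nat) (avail : seq nat) : bool :=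
  if k is k'.+1 then
    has (fun y =>
      if core_rel x y then arc_search t k' y (filter (predC1 y) avail)
      else false) avail
  else core_rel x t && all (mem [:: 0; 1]) avail.

(** Completeness of the search: if it fails, no such path exists. *)
Lemma arc_searchP t x p avail :
  path core_rel x p -> core_rel (last x p) t -> uniq p ->
  {subset p <= avail} ->
  (forall y, y \in avail -> y \notin p -> y \in [:: 0; 1]) ->
  arc_search t (size p) x avail.
Proof.
elim: p x avail => [|y p IH] x avail /=.
  by move=> _ -> _ _ skip; apply/allP=> y /skip; apply.
move=> /andP[xy yp] pt /andP[y_p uniq_p] sub_p skip.
apply/hasP; exists y; first by apply: sub_p; rewrite mem_head.
rewrite xy; apply: IH => // z.
  move=> zp; rewrite mem_filter /= sub_p ?inE ?zp ?orbT // andbT.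
  by apply: contraNneq y_p => <-.
rewrite mem_filter /= => /andP[zy za] zp.
by apply: skip; rewrite // inE negb_or zy.
Qed.

(** The core without 4, 5 and the clique; 0 and 1 come first, so that [drop 2] leaves the mandatory
    vertices. *)
Definition core_avail : seq nat := [:: 0; 1; 2; 3; 6; 7; 8; 9; 10; 11; 12; 13].

(** Ten vertices are mandatory, so size 11 means that exactly one of 0 and 1 is visited. *)
Lemma no_core_arc a b p :
  (a, b) \in [:: (4, 5); (5, 4)] ->
  path blowup_adj a p -> blowup_adj (last a p) b -> uniq p ->
  all (fun x => x < 14) p -> 4 \notin p -> 5 \notin p ->
  {subset drop 2 core_avail <= p} -> size p <> 11.
Proof.
move=> ab path_p last_p uniq_p small_p p4 p5 sub_p size_p.
have no_arc : all (fun ab : nat * nat =>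
    ~~ arc_search ab.2 11 ab.1 core_avail) [:: (4, 5); (5, 4)].
  by vm_compute.
move/allP/(_ _ ab)/negP: no_arc; apply; rewrite -size_p /=.
have a14 : a < 14 by move: ab; rewrite !inE => /orP[] /eqP[-> _].
have b14 : b < 14 by move: ab; rewrite !inE => /orP[] /eqP[_ ->].
have small_core x y : x < 14 -> y < 14 -> blowup_adj x y -> core_rel x y.
  by move=> x14 y14 /andP[_]; rewrite /fold14 !(minn_idPl _) // ltnW.
have l14 : last a p < 14.
  have := mem_last a p; rewrite inE => /orP[/eqP-> //|].
  exact: (allP small_p).
apply: arc_searchP => //.
- have small_ap : all (fun x => x < 14) (a :: p) by rewrite /= a14.
  apply: (sub_in_path (P := [pred x | x < 14])) small_ap path_p.
  by move=> x y; rewrite !inE; apply: small_core.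
- exact: small_core.
- move=> y yp; have := allP small_p _ yp.
  have : y != 4 by apply: contraNneq p4 => <-.
  have : y != 5 by apply: contraNneq p5 => <-.
  by move: (y) => z; rewrite !inE; lia.
- move=> y; rewrite -[core_avail](cat_take_drop 2) mem_cat.
  by case/orP=> [//|/sub_p ->].
Qed.

(** * Lengths of cycles missing at most 0 and 1 *)

Definition covers (n : nat) (u v : seq nat) : Prop :=
  forall x, 1 < x < n -> x != 4 -> x != 5 -> (x \in u) || (x \in v).

Lemma clique_arc_size n u v :
  covers n u v -> all (fun x => x < 14) u -> all (leq 14) v ->
  all (fun x => x < n) v -> uniq v -> size v = n - 14.
Proof.
move=> cov small_u large_v lt_v uniq_v.
rewrite -(size_iota 14 (n - 14)); apply/perm_size/uniq_perm => //.
  exact: iota_uniq.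
move=> x; rewrite mem_iota; apply/idP/idP => [xv|x_range].
  by move: (allP lt_v x xv) (allP large_v x xv) => /= {cov}; lia.
have x14 : 14 <= x by case/andP: x_range.
have /orP[/(allP small_u)|//] : (x \in u) || (x \in v).
  by apply: cov; move: x_range {small_u large_v lt_v uniq_v}; lia.
by rewrite /= ltnNge x14.
Qed.

Lemma core_sub_arc n u v :
  14 < n -> covers n u v -> all (leq 14) v -> {subset drop 2 core_avail <= u}.
Proof.
move=> n14 cov large_v x x_core.
have x_small : [&& 1 < x, x < 14, x != 4 & x != 5].
  by move: x_core {large_v cov}; rewrite !inE; lia.
case/and4P: x_small => x1 x14 x4 x5.
have /orP[//|/(allP large_v)] : (x \in u) || (x \in v).
  by apply: cov => //; rewrite x1 (ltn_trans x14).
by rewrite leqNgt x14.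
Qed.

(** The arc [q] is the whole clique, which would leave 11 vertices for [p]. *)
Lemma arc_sizes_neq n a b p q :
  (a, b) \in [:: (4, 5); (5, 4)] -> 14 < n -> covers n p q ->
  path blowup_adj a p -> blowup_adj (last a p) b -> uniq p -> uniq q ->
  4 \notin p -> 5 \notin p ->
  all (fun x => x < 14) p -> all (leq 14) q -> all (fun x => x < n) q ->
  size p + size q <> n - 3.
Proof.
move=> ab n14 cov path_p last_p uniq_p uniq_q p4 p5 small_p large_q lt_q.
rewrite (clique_arc_size n p q) // => size_p.
apply: (no_core_arc a b p) => //.
  exact: core_sub_arc n p q n14 cov large_q.
by move: n14 size_p; clear; lia.
Qed.

Lemma blowup_cycle_size n (s : seq nat) :
  14 < n -> uniq s -> cycle blowup_adj s -> all (fun x => x < n) s ->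
  (forall x, 1 < x < n -> x \in s) -> size s <> n.-1.
Proof.
move=> n14 uniq_s cyc_s lt_s sub_s size_s.
have sub14 x : 1 < x < 15 -> x \in s.
  by case/andP=> x1 x15; apply: sub_s; rewrite x1 (leq_trans x15).
(* Cut the cycle at 4 and 5 into two arcs [p] and [q]. *)
have [i [p [q def_s]]] : exists i (p q : seq nat), rot i s = 4 :: p ++ 5 :: q.
  have [i r def_r] := rot_to (sub14 4 isT).
  have r5 : 5 \in r.
    by have := sub14 5 isT; rewrite -(mem_rot i) def_r inE.
  by case/splitPr: r / r5 def_r => p q def_r; exists i, p, q.
have mem_s x : (x \in s) = (x \in 4 :: p ++ 5 :: q).
  by rewrite -def_s mem_rot.
move: uniq_s cyc_s size_s lt_s.
rewrite -(rot_uniq i) -(rot_cycle i) -(size_rot i).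
rewrite -(eq_all_r (mem_rot i s)) def_s /=.
rewrite mem_cat inE negb_or cat_uniq /= size_cat /= all_cat /=.
case/and3P=> /andP[p4 q4] uniq_p /and3P[/norP[p5 _] q5 uniq_q].
rewrite rcons_cat rcons_cons cat_path /= rcons_path.
case/and4P=> path_p p_5 path_q q_4 size_pq /and4P[_ lt_p _ lt_q].
have {}size_pq : size p + size q = n - 3.
  by move: size_pq n14; clear; lia.
have cov_pq : covers n p q.
  move=> x /sub_s; rewrite mem_s !(inE, mem_cat).
  by case/or4P=> [/eqP->||/eqP->|] // -> _ _; rewrite ?orbT.
have cov_qp : covers n q p by move=> x; rewrite orbC; apply: cov_pq.
have cov14 x : 1 < x < 15 -> x != 4 -> x != 5 -> (x \in p) || (x \in q).
  by case/andP=> x1 x15; apply: cov_pq; rewrite x1 (leq_trans x15).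
(* Each arc lies on one side of the separator. If both lie on the same side, 14 or 2 is not
   covered. *)
have [small_p|large_p] := path_avoiding_separator _ (path_sorted path_p) p4 p5;
have [small_q|large_q] := path_avoiding_separator _ (path_sorted path_q) q4 q5.
- by have /orP[/(allP small_p)|/(allP small_q)] := cov14 14 isT isT isT.
- by apply: (arc_sizes_neq n 4 5 p q).
- by rewrite addnC in size_pq; apply: (arc_sizes_neq n 5 4 q p).
- by have /orP[/(allP large_p)|/(allP large_q)] := cov14 2 isT isT isT.
Qed.

(** * Induced paths *)

Definition path_extensions (q : seq nat) : seq nat :=
  [seq x <- iota 0 15 |
     (if q is y :: _ then core_rel x y else true) &&
     all (fun z => ~~ core_rel x z) (behead q)].

Arguments path_extensions : simpl never.

Fixpoint core_paths (k : nat) : seq (seq nat) :=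
  if k is k'.+1 then
    [seq x :: q | q <- core_paths k', x <- path_extensions q]
  else [:: [::]].

Definition blowup (n : nat) : sgraph.
Proof.
refine (@SGraph 'I_n (relpre val blowup_adj) _ _).
  by move=> x y; apply: blowup_adj_sym.
by move=> x; rewrite /= /blowup_adj eqxx.
Defined.

(* Two twins of the blown-up vertex have the same closed neighbourhood, so
   folding needs no injectivity: [core_rel] is reflexive and [core_paths] admits
   the repetitions that consecutive twins would create. *)
Lemma induced_path_fold n (p : seq (blowup n)) :
  induced_path p ->
  [seq fold14 (val x) | x <- p] \in core_paths (size p).
Proof.
elim: p => [|x p IH] //= [/= /andP[xp uniq_p] path_p chordless_p].
have neq_x y : y \in p -> (x == y) = false.
  by move=> yp; apply: contraNF xp => /eqP->.
apply/allpairsPdep; exists [seq fold14 (val y) | y <- p], (fold14 (val x)).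
split=> //.
  apply: IH; split=> //; first exact: path_sorted path_p.
  move=> y z yp zp yz.
  have := chordless_p y z.
  rewrite !inE yp zp !orbT /= !neq_x // => /(_ isT isT yz).
  by case=> [[->]|[->]]; [left | right].
rewrite /path_extensions mem_filter fold14_lt15 andbT.
case: p => [//|y p] /= in xp uniq_p path_p chordless_p neq_x {IH} *.
case/andP: path_p => /andP[_ ->] _ /=.
apply/allP=> _ /mapP[z zp ->]; apply/negP=> xz.
have zyp : z \in y :: p by rewrite inE zp orbT.
have adj_xz : adj (x : blowup n) z.
  by rewrite /= /blowup_adj xz andbT; apply/eqP=> /val_inj/eqP; rewrite neq_x.
have := chordless_p x z; rewrite mem_head inE zyp orbT => /(_ isT isT adj_xz).
rewrite eqxx (neq_x z zyp).
have -> : (y == z) = false by apply: contraTF uniq_p => /eqP->; rewrite zp.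
by case.
Qed.

(** * Cycles that run through the whole clique *)

Lemma ord_seq_lift n (s : seq nat) :
  all (fun x => x < n) s -> exists c : seq 'I_n, map val c = s.
Proof.
move=> lt_s; exists (pmap insub s).
rewrite (pmap_filter (insubK _)); apply/all_filterP.
by rewrite (eq_all (isSome_insub _)).
Qed.

Lemma blowup_is_cycle n (c : seq (blowup n)) :
  2 < size c -> uniq (map val c) -> cycle blowup_adj (map val c) ->
  is_cycle c.
Proof.
move=> size_c; rewrite (map_inj_uniq val_inj) cycle_map => uniq_c cyc_c.
by split=> //; apply/andP.
Qed.

Lemma clique_path x k :
  13 < x -> path blowup_adj x (rcons (iota x.+1 k) 5).
Proof.
elim: k x => [|k IH] x x13 /=.
  rewrite /blowup_adj /fold14 (minn_idPr x13) andbT.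
  by apply/andP; split=> //; lia.
rewrite IH ?leqW // andbT /blowup_adj /fold14.
by rewrite (minn_idPr x13) (minn_idPr (leqW x13)) andbT; lia.
Qed.

Lemma clique_closed_cycle p k :
  path blowup_adj 5 (rcons p 4) ->
  cycle blowup_adj (5 :: rcons p 4 ++ iota 14 k.+1).
Proof.
move=> path_p; rewrite /= rcons_cat cat_path path_p last_rcons /=.
by rewrite clique_path.
Qed.

(** Reduces a cycle for arbitrary [n] to a fixed path from 5 to 4 in the core, checkable by
    computation. *)
Lemma core_clique_cycle n p (q := 5 :: rcons p 4 ++ iota 14 (n - 14)) :
  14 < n -> path blowup_adj 5 (rcons p 4) -> uniq (5 :: rcons p 4) ->
  all (fun x => x < 14) (rcons p 4) ->
  exists2 c : seq (blowup n), is_cycle c & map val c = q.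
Proof.
move=> n14 path_p uniq_p small_p.
have [|c def_c] := ord_seq_lift n q.
  rewrite /q /= all_cat; apply/and3P; split; first lia.
    by apply: sub_all small_p => x /=; lia.
  by apply/allP=> x; rewrite mem_iota; lia.
exists c => //; apply: blowup_is_cycle; rewrite ?def_c.
- rewrite -(size_map val) def_c /q /= size_cat size_rcons size_iota; lia.
- rewrite /q -cat_cons cat_uniq uniq_p iota_uniq andbT /=.
  apply/hasPn=> x; rewrite mem_iota => x14; apply/negP; rewrite inE.
  by case/orP=> [/eqP|/(allP small_p)]; lia.
- by rewrite /q (_ : n - 14 = (n - 15).+1) ?clique_closed_cycle //; lia.
Qed.

Theorem theorem3p1 (n : nat) (hn : 15 <= n) :
  exists G : sgraph,
    #|G| = n /\ connected_graph G /\
    hamiltonian G /\ chordal G /\ ~ fully_cycle_extendible G /\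
    ~ (exists p : seq G, induced_path p /\ size p = 9).
Proof.
(* With its ends 5 and 4, this path visits all of 0 to 13, so [c] is Hamiltonian. *)
have [c cyc_c def_c] :=
  core_clique_cycle n [:: 0; 1; 6; 10; 2; 11; 9; 8; 13; 3; 12; 7]
    hn isT isT isT.
(* [d] misses exactly 0 and 1. *)
have [d cyc_d def_d] :=
  core_clique_cycle n [:: 9; 11; 2; 10; 6; 7; 12; 3; 13; 8] hn isT isT isT.
have all_c x : x \in c.
  case: x => x xn; rewrite -(mem_map val_inj) def_c -cat_cons mem_cat mem_iota.
  by rewrite /= !inE; lia.
exists (blowup n); split; first exact: card_ord.
split.
  split; first by rewrite card_ord; lia.
  by move=> x y; case: cyc_c => _ /andP[/connect_cycle conn _]; apply: conn.
split; first by exists c.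
split.
  apply: (perfect_elimination_chordal (blowup n) _ (@ord_inj n)) => x y z.
  exact: blowup_elimination.
split.
  (* [d] misses 0 and has length [n - 2]; an extension would have length [n - 1], which
     [blowup_cycle_size] excludes. *)
  case=> ext _; case: (ext d cyc_d).
    case=> _ /(_ (Ordinal (ltn_trans (isT : 0 < 14) hn))).
    by rewrite -(mem_map val_inj) def_d -cat_cons mem_cat mem_iota.
  move=> e [[_ /andP[cyc_e uniq_e]] sub_de size_e].
  apply: (blowup_cycle_size n (map val e) hn).
  - by rewrite (map_inj_uniq val_inj).
  - by rewrite cycle_map.
  - by apply/allP=> _ /mapP[x _ ->]; apply: ltn_ord.
  - move=> x x_range; have xn : x < n by lia.
    rewrite -[x]/(val (Ordinal xn)) (mem_map val_inj); apply: sub_de.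
    rewrite -(mem_map val_inj) def_d -cat_cons mem_cat mem_iota /= !inE; lia.
  - rewrite size_map size_e -(size_map val d) def_d /= size_iota; lia.
case=> p [/induced_path_fold + size_p]; rewrite size_p.
by have -> : core_paths 9 = [::] by vm_compute.
Qed.
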